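(* Fix an integer $q \geq 3$. For positive integers $f, m$ with $(q-1)m < f < qm$, let $N(f,m)$ denote the number of numerical semigroups with multiplicity $m$ and Frobenius number $f$, and put $\alpha := f/m - (q-1) \in (0,1)$. Then, as $(f,m)$ varies subject to $(q-1)m < f < qm$, \[N(f,m) = \left(c_q^{\alpha}\, c_{q-1}^{1-\alpha}\right)^{m + o(m)},\] where $o(m)$ denotes a quantity $E(f,m)$ with $E(f,m)/m \to 0$ as $m \to \infty$ (uniformly over the admissible $f$).
   Context: A numerical semigroup is a subset $\Lambda \subseteq \mathbb{N}_0$ containing $0$, closed under addition, with finite complement. Its multiplicity is $m(\Lambda) = \min(\Lambda \setminus \{0\})$, its conductor $c(\Lambda)$ is the least $c \in \mathbb{N}_0$ with $c + \mathbb{N}_0 \subseteq \Lambda$, and its Frobenius number is $f(\Lambda) = c(\Lambda) - 1$. For $q \geq 1$, $c_q := \sqrt{\lfloor (q+2)^2/4 \rfloor}$. *)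

(* Defs.v *)
From Stdlib Require Import Reals.
From mathcomp Require Import all_boot.
From mathcomp Require Import boolp.

Set Implicit Arguments.
Unset Strict Implicit.
Unset Printing Implicit Defensive.

Definition is_numerical_semigroup (L : nat -> Prop) : Prop :=
  L 0%N /\ (forall x y, L x -> L y -> L (x + y)%N) /\
  exists c, forall n, (c <= n)%N -> L n.

Definition has_multiplicity (L : nat -> Prop) (m : nat) : Prop :=
  (0 < m)%N /\ L m /\ forall k, (0 < k)%N -> (k < m)%N -> ~ L k.

Definition has_conductor (L : nat -> Prop) (c : nat) : Prop :=
  (forall n, (c <= n)%N -> L n) /\
  forall c', (forall n, (c' <= n)%N -> L n) -> (c <= c')%N.

(* f(L) = c(L) - 1; here only needed for f a natural number. *)
Definition has_frobenius (L : nat -> Prop) (f : nat) : Prop :=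
  has_conductor L f.+1.

Definition ext_set (f : nat) (S : {set 'I_f.+1}) : nat -> Prop :=
  fun x => if (x <= f)%N then (inord x : 'I_f.+1) \in S else true.

(* N(f,m): number of numerical semigroups with multiplicity m and Frobenius
   number f.  Such a semigroup contains every integer > f, hence is uniquely
   determined by its intersection with {0,...,f}; we count these traces. *)
Definition N_count (f m : nat) : nat :=
  #|[set S : {set 'I_f.+1} |
      `[< is_numerical_semigroup (ext_set S) /\
          has_multiplicity (ext_set S) m /\
          has_frobenius (ext_set S) f >] ]|.

Definition c_ (q : nat) : R := sqrt (INR (((q + 2) ^ 2) %/ 4)%N).

Definition alpha (q f m : nat) : R := Rminus (Rdiv (INR f) (INR m)) (Rminus (INR q) R1).

(* Main.v *)
Require Import Defs.
From Stdlib Require Import Reals Lra.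
From Coquelicot Require Rcomplements.
From mathcomp Require Import all_boot ssralg zmodp zify.
From mathcomp Require Import boolp.

(** Write f = (q - 1) m + r.  A semigroup of multiplicity m is encoded by its
    Kunz word k, indexed by Z/m, where k_i m + i is its least element congruent
    to i; the conditions on k are k_(i+j) <= k_i + k_j, with 1 added on the right
    when i + j wraps around m.  Here k_r = q, k_i <= q, and k_i < q for i > r.

    Lower bound: a box of words with all entries at least about q/2 satisfies
    every condition, and the product of its sides over a pair {i, r - i} is
    floor((q+2)^2/4) if i <= r and floor((q+1)^2/4) if i > r.

    Upper bound: fix a large D, let p be the largest value such that at least D
    entries are >= p, and let S be the D largest positions of such entries.
    Every s in S forces k_i + k_(s-i) >= p (or p - 1, if i > s).  A small set F of
    positions, chosen greedily, already forces through these inequalities almost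
    everything that the whole word forces.  Among the words with given S, F and
    values on F, let lo_i be the least value of k_i: then
    lo_i + lo_(s-i) >= p (or p - 1) for most pairs (i, s), so some s in S is good
    for almost all i, and pairing i with s - i bounds the number of these words
    by the product of the sides of the box above, up to a factor exp(o(m)). *)

Set Implicit Arguments.
Unset Strict Implicit.
Unset Printing Implicit Defensive.

Import GRing.Theory.

(* [ssralg] binds the key [R] to [ring_scope]. *)
Delimit Scope R_scope with Re.

Lemma sum_card_sections (I J : finType) (A : {set I}) (B : {set J})
    (P : I -> J -> bool) :
  \sum_(i in A) #|[set j in B | P i j]| = \sum_(j in B) #|[set i in A | P i j]|.
Proof.
under eq_bigr do rewrite -sum1dep_card big_mkcondr /=.
under [RHS]eq_bigr do rewrite -sum1dep_card big_mkcondr /=.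
exact: exchange_big.
Qed.

Lemma exists_large_fiber (T C : finType) (A : {set T}) (codes : {set C})
    (P : T -> C -> bool) : A != set0 ->
  (forall x, x \in A -> exists2 c, c \in codes & P x c) ->
  exists2 c, c \in codes & #|A| <= #|codes| * #|[set x in A | P x c]|.
Proof.
move=> /set0Pn[x0 x0A] coded; have [c0 c0C _] := coded x0 x0A.
have [c cC cmax] : exists2 c, c \in codes &
    forall c', c' \in codes -> #|[set x in A | P x c']| <= #|[set x in A | P x c]|.
  by exists [arg max_(c > c0 in codes) #|[set x in A | P x c]|]; case: arg_maxnP.
exists c => //; rewrite -sum_nat_const.
apply: (@leq_trans (\sum_(c' in codes) #|[set x in A | P x c']|)); last exact: leq_sum.
rewrite -sum_card_sections -sum1_card; apply: leq_sum => x xA.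
have [c' c'C Pxc'] := coded x xA.
by apply/card_gt0P; exists c'; rewrite inE c'C.
Qed.

Lemma exists_small_section (I J : finType) (A : {set I}) (P : I -> J -> bool) t :
  A != set0 -> (forall j, #|[set i in A | P i j]| <= t) ->
  exists2 i, i \in A & #|A| * #|[set j | P i j]| <= #|J| * t.
Proof.
move=> /set0Pn[i0 i0A] le_t.
have [i iA imin] : exists2 i, i \in A &
    forall i', i' \in A -> #|[set j | P i j]| <= #|[set j | P i' j]|.
  by exists [arg min_(i < i0 in A) #|[set j | P i j]|]; case: arg_minnP.
exists i => //; rewrite -!sum_nat_const.
apply: (@leq_trans (\sum_(i' in A) #|[set j | P i' j]|)); first exact: leq_sum.
rewrite (eq_bigr (fun i' => #|[set j in setT | P i' j]|)) => [|i' _].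
  by rewrite sum_card_sections big_mkcond; apply: leq_sum => j _; rewrite in_setT.
by apply: eq_card => j; rewrite !inE.
Qed.

Lemma exists_top_subset (I : finType) (v : I -> nat) (A : {set I}) D : D <= #|A| ->
  exists S : {set I}, [/\ S \subset A, #|S| = D &
    forall i s, i \in A -> s \in S -> v s < v i -> i \in S].
Proof.
elim: D => [_|D IHD ltDA].
  by exists set0; split=> [||i s _]; rewrite ?sub0set ?cards0 ?inE.
have [S [SA cardS top]] := IHD (ltnW ltDA).
have /card_gt0P[x0 x0AS] : 0 < #|A :\: S| by rewrite cardsD (setIidPr SA) cardS subn_gt0.
have [x xAS xmax] : exists2 x, x \in A :\: S & forall y, y \in A :\: S -> v y <= v x.
  by exists [arg max_(x > x0 in A :\: S) v x]; case: arg_maxnP.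
have /setDP[xA xS] := xAS.
exists (x |: S); split; first by rewrite subUset sub1set xA.
  by rewrite cardsU1 xS cardS.
move=> i s iA; rewrite !inE => /orP[/eqP-> | sS] lt_vi; apply/orP; right.
  apply: contraLR lt_vi => iS; rewrite -leqNgt; apply: xmax.
  by rewrite inE iA iS.
exact: top iA sS lt_vi.
Qed.

Lemma card_le_prod_images (I T : finType) (A : {set {ffun I -> T}}) :
  #|A| <= \prod_i #|[set g i | g : {ffun I -> T} in A]|.
Proof.
rewrite -cardsXn; apply: subset_leq_card; apply/subsetP => g gA.
by apply/setXnP => i; apply: imset_f.
Qed.

Lemma card_ord_interval n a b : b <= n -> #|[set v : 'I_n.+1 | a <= v <= b]| = b.+1 - a.
Proof.
move=> le_bn; rewrite cardE -(size_iota a (b.+1 - a)) -(size_map (@nat_of_ord _)).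
apply/perm_size/uniq_perm; rewrite ?iota_uniq ?map_inj_uniq ?enum_uniq //.
  exact: ord_inj.
move=> x; rewrite mem_iota; apply/mapP/idP => [[v + ->]|x_in].
  by rewrite mem_enum inE; lia.
by exists (inord x); rewrite ?mem_enum ?inE inordK; lia.
Qed.

Lemma leq_card_setUD (T : finType) (A B : {set T}) a b :
  #|A| <= a -> #|B| <= b -> #|A :|: B| <= a + b.
Proof.
by move=> le_a le_b; apply: leq_trans (leq_card_setU A B).1 (leq_add le_a le_b).
Qed.

Section DominatingSet.
Variables (I J : finType) (w : I -> J -> nat).
Implicit Types F : {set I}.

Definition undominated F i : {set J} := [set j | \max_(i' in F) w i' j < w i j].

Lemma undominated_subset F F' i :
  F \subset F' -> undominated F' i \subset undominated F i.
Proof.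
move=> FF'; apply/subsetP => j; rewrite !inE; apply: leq_ltn_trans.
apply/bigmax_leqP => i' i'F.
exact: (@leq_bigmax_cond _ (mem F') (fun i' => w i' j)) (subsetP FF' _ i'F).
Qed.

(* [F] is optimal for the trade-off between the sum of the column maxima and [t]
   times the size of [F]: adding a row with more than [t] undominated columns
   would be profitable. *)
Lemma exists_dominating_set b t : (forall i j, w i j <= b) ->
  exists2 F : {set I}, t * #|F| <= #|J| * b & forall i, #|undominated F i| <= t.
Proof.
move=> w_le; pose colmax F := \sum_j \max_(i in F) w i j.
pose value F := colmax F + t * #|~: F|.
have [F Fmax] : exists F, forall F', value F' <= value F.
  by exists [arg max_(F > set0) value F] => F'; case: arg_maxnP => // F0 _; apply.
exists F => [|i].
  have colmax_le : colmax F <= #|J| * b.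
    by rewrite -sum_nat_const; apply: leq_sum => j _; apply/bigmax_leqP.
  have := leq_trans (leq_addl _ _) (Fmax set0).
  by rewrite /value setC0 cardsT -(cardsC F); lia.
rewrite leqNgt; apply/negP => lt_t.
have iF : i \notin F.
  apply: contraL lt_t => iF; rewrite -leqNgt (_ : undominated F i = set0) ?cards0 //.
  by apply/setP => j; rewrite !inE ltnNge (@leq_bigmax_cond _ (mem F) (fun i' => w i' j)).
have gain : colmax F + #|undominated F i| <= colmax (i |: F).
  rewrite -sum1_card [X in _ + X]big_mkcond -big_split /=.
  apply: leq_sum => j _; rewrite big_setU1 //= inE.
  by case: ltnP => lt_max; rewrite ?addn0 ?addn1.
have := Fmax (i |: F); apply/negP; rewrite -ltnNge /value.
have -> : #|~: F| = #|~: (i |: F)|.+1.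
  by have := cardsC F; rewrite -(cardsC (i |: F)) cardsU1 iF; lia.
by rewrite mulnS; lia.
Qed.

End DominatingSet.

Section PartialMaps.
Variables (I T : finType).

Definition domain (g : {ffun I -> option T}) : {set I} := [set i | g i != None].

Definition small_partial_maps B : {set {ffun I -> option T}} :=
  [set g | #|domain g| <= B].

Lemma card_small_partial_maps_gt0 B : 0 < #|small_partial_maps B|.
Proof.
apply/card_gt0P; exists [ffun=> None]; rewrite inE.
by rewrite (_ : domain _ = set0) ?cards0 //; apply/setP => i; rewrite !inE ffunE.
Qed.

(* Weighting every undefined entry by [y] (an exponential Chernoff bound). *)
Lemma card_small_partial_maps B y : 0 < y ->
  y ^ #|I| * #|small_partial_maps B| <= y ^ B * (y + #|T|) ^ #|I|.
Proof.
move=> y_gt0; pose weight (o : option T) := if o is Some _ then 1 else y.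
have sum_weight : \sum_o weight o = y + #|T|.
  rewrite (bigD1 None) //= (eq_bigr (fun=> 1)) => [|[]//].
  by rewrite sum1_card cardC1 card_option.
have -> : (y + #|T|) ^ #|I| = \sum_(g : {ffun I -> option T}) \prod_i weight (g i).
  by rewrite -(bigA_distr_bigA (fun=> weight)) /= sum_weight prod_nat_const.
rewrite mulnC -sum_nat_const big_distrr /= [leqLHS]big_mkcond /=.
apply: leq_sum => g _; rewrite inE; case: ifP => // le_B.
have -> : \prod_i weight (g i) = y ^ #|~: domain g|.
  rewrite -prod_nat_const [RHS]big_mkcond /=; apply: eq_bigr => i _.
  by rewrite !inE negbK /weight; case: (g i).
by rewrite -expnD leq_pexp2l // -(cardsC (domain g)) leq_add2r.
Qed.

End PartialMaps.

Definition csq (q : nat) : nat := ((q + 2) ^ 2) %/ 4.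

Lemma csq_gt0 q : 0 < csq q.
Proof. by rewrite divn_gt0 // -mulnn; nia. Qed.

Lemma leq_csq : {homo csq : p q / p <= q}.
Proof. by move=> p q le_pq; apply: leq_div2r; rewrite leq_exp2r // leq_add2r. Qed.

Lemma leq_mul_csq x y q : x + y <= q + 2 -> x * y <= csq q.
Proof.
move=> le_xy; rewrite leq_divRL // mulnC.
by apply: leq_trans (nat_AGM2 x y).1 _; rewrite leq_exp2r.
Qed.

Lemma csqE q : csq q = (uphalf q).+1 * q./2.+1.
Proof.
rewrite /csq uphalf_half -{1}(odd_double_half q); move: q./2 => h; case: odd.
  by rewrite (_ : _ ^ 2 = (h.+2 * h.+1) * 4 + 1) ?divnMDl ?addn0 // -mulnn; nia.
by rewrite (_ : _ ^ 2 = (h.+1 * h.+1) * 4) ?mulnK // -mulnn; nia.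
Qed.

Section ModularArithmetic.
Variable m' : nat.
Local Notation m := m'.+1.
Implicit Types i j s : 'I_m.

Lemma val_Zp_add i j :
  (i + j : 'I_m)%R = (if i + j < m then i + j else i + j - m) :> nat.
Proof.
rewrite /=; case: ltnP => [/modn_small // | le_m].
rewrite -{1}(subnK le_m) modnDr modn_small //.
by have := ltn_ord i; have := ltn_ord j; lia.
Qed.

Lemma Zp_sub_carry s i : (m <= i + (s - i : 'I_m)%R) = (s < i).
Proof.
have := val_Zp_add i (s - i)%R; rewrite addrC subrK.
by have := ltn_ord i; have := ltn_ord (s - i)%R; case: ifP; lia.
Qed.

Lemma ltn_Zp_sub s i : (s < (s - i : 'I_m)%R) = (s < i).
Proof. by rewrite -!Zp_sub_carry subKr addnC. Qed.

Lemma inZpMDl n i : inZp (n * m + i) = i.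
Proof. by apply: val_inj; rewrite /= modnMDl modn_small. Qed.

Lemma inZpD x y : inZp (x + y) = (inZp x + inZp y)%R :> 'I_m.
Proof. by apply: val_inj; rewrite /= modnDm. Qed.

Lemma divnMDord n i : (n * m + i) %/ m = n.
Proof. by rewrite divnMDl // divn_small // addn0. Qed.

End ModularArithmetic.

Definition semigroup_with (m f : nat) (L : nat -> Prop) : Prop :=
  is_numerical_semigroup L /\ has_multiplicity L m /\ has_frobenius L f.

Section KunzWords.
Variables (q m' : nat).
Local Notation m := m'.+1.
Local Notation word := {ffun 'I_m -> 'I_q.+1}.
Implicit Types (k : word) (i j r : 'I_m) (L : nat -> Prop).

Definition kunz k : bool :=
  [forall i : 'I_m, forall j : 'I_m, k (i + j)%R <= k i + k j + (m <= i + j)].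

Lemma kunzP k :
  reflect (forall i j : 'I_m, k (i + j)%R <= k i + k j + (m <= i + j)) (kunz k).
Proof. exact: 'forall_forallP. Qed.

Definition level (p s i : nat) : nat := p - (s < i).

Definition semigroup_word r k : bool :=
  [&& kunz k, k r == ord_max, [forall i : 'I_m, k i <= level q r i] &
      [forall i : 'I_m, (k i == ord0) == (i == 0%R)]].

Definition kunz_set k : nat -> Prop := fun x => k (inZp x) <= x %/ m.

Lemma kunz_setE k n i : kunz_set k (n * m + i) = (k i <= n) :> Prop.
Proof. by rewrite /kunz_set inZpMDl divnMDord. Qed.

Lemma kunz_set_inj : injective kunz_set.
Proof.
move=> k k' eqL; apply/ffunP => i; apply/ord_inj/eqP.
have le_eq n : k i <= n <-> k' i <= n by rewrite -!kunz_setE eqL.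
by rewrite eqn_leq; apply/andP; split; apply/le_eq.
Qed.

Lemma kunz_set_closedP k :
  (forall x y, kunz_set k x -> kunz_set k y -> kunz_set k (x + y)) <-> kunz k.
Proof.
split=> [addL | /kunzP kunz_k x y Lx Ly].
  apply/kunzP => i j; have := addL (k i * m + i) (k j * m + j).
  rewrite !kunz_setE !leqnn -kunz_setE => /(_ isT isT); congr (kunz_set k _).
  rewrite val_Zp_add !mulnDl.
  by have := ltn_ord i; have := ltn_ord j; case: (ltnP (i + j) m); lia.
rewrite /kunz_set inZpD divnD //; apply: leq_trans (kunz_k _ _) _.
by rewrite leq_add2r leq_add.
Qed.

Lemma kunz_set_multiplicityP k :
  is_numerical_semigroup (kunz_set k) /\ has_multiplicity (kunz_set k) m <->
  kunz k /\ forall i : 'I_m, (k i == ord0) = (i == 0%R).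
Proof.
rewrite /is_numerical_semigroup kunz_set_closedP.
have kunz_set_lt i : kunz_set k i <-> k i = ord0.
  rewrite -{1}[nat_of_ord i]add0n -(mul0n m) kunz_setE leqn0.
  by split=> [/eqP k0 | -> //]; apply: ord_inj.
split=> [[[/(kunz_set_lt 0%R) k0 [kunz_k _]] [_ [_ k_gt0]]] | [kunz_k k0]].
  split=> // i; have [-> | i0] := eqVneq i 0%R; first exact/eqP.
  apply/eqP => /kunz_set_lt; apply: k_gt0; last exact: ltn_ord.
  by rewrite lt0n.
have k00 : k 0%R = ord0 by apply/eqP; rewrite k0.
split; split=> //; first exact/(kunz_set_lt 0%R).
- split=> //; exists (q * m) => n le_n; apply: leq_trans (_ : q <= _).
    by rewrite -ltnS.
  by rewrite leq_divRL.
- split=> [|x x_gt0 lt_x].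
    by rewrite -[m]addn0 -{1}[m]mul1n (kunz_setE _ _ 0%R) k00.
  rewrite -[x]/(nat_of_ord (Ordinal lt_x)) => /kunz_set_lt/eqP; rewrite k0.
  by rewrite -val_eqE /= eqn0Ngt x_gt0.
Qed.

Lemma kunz_set_frobeniusP k r : 0 < q ->
  has_frobenius (kunz_set k) ((q - 1) * m + r) <->
  k r = ord_max /\ forall i : 'I_m, k i <= level q r i.
Proof.
move=> q_gt0; split=> [[gtf minf] | [kr k_le]].
  have k_le i : k i <= level q r i.
    have le_q : k i <= q by rewrite -ltnS.
    rewrite /level; case: (ltnP r i) => [lt_ri | _]; last by rewrite subn0.
    by rewrite -kunz_setE; apply: gtf; rewrite ltn_add2l.
  split=> //; apply: ord_inj; apply/eqP; rewrite eqn_leq -ltnS ltn_ord leqNgt /=.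
  apply/negP => lt_kr; suff /minf : forall n, (q - 1) * m + r <= n -> kunz_set k n.
    by rewrite ltnn.
  move=> n; rewrite leq_eqVlt => /predU1P[<- | /gtf //].
  by rewrite kunz_setE; lia.
split=> [n lt_n | c c_le].
  rewrite (divn_eq n m) -[n %% m]/(nat_of_ord (inZp n : 'I_m)) kunz_setE.
  apply: leq_trans (k_le _) _; rewrite /level /=; move: lt_n.
  rewrite {1}(divn_eq n m); have := ltn_pmod n (ltn0Sn m'); case: ltnP; nia.
rewrite ltnNge; apply/negP => /c_le; rewrite kunz_setE kr /=; lia.
Qed.

Lemma semigroup_wordP k r : 0 < q ->
  reflect (semigroup_with m ((q - 1) * m + r) (kunz_set k)) (semigroup_word r k).
Proof.
move=> q_gt0; apply: (iffP and4P) => [[kunz_k /eqP kr /forallP k_le /forallP k0]|].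
  have [semi mult] :
      is_numerical_semigroup (kunz_set k) /\ has_multiplicity (kunz_set k) m.
    by apply/kunz_set_multiplicityP; split=> // i; apply: eqP (k0 i).
  by split; [|split] => //; apply/kunz_set_frobeniusP.
move=> [semi [mult /(kunz_set_frobeniusP k r q_gt0)[kr k_le]]].
have /kunz_set_multiplicityP[kunz_k k0] := conj semi mult.
by split=> //; [apply/eqP | apply/forallP | apply/forallP => i; apply/eqP].
Qed.

Lemma exists_least_in_class L i : is_numerical_semigroup L -> L m ->
  exists n0, forall n, L (n * m + i) <-> n0 <= n.
Proof.
move=> [_ [addL [c c_le]]] Lm.
have up n d : L (n * m + i) -> L ((n + d) * m + i).
  move=> Ln; elim: d => [|d Lnd]; first by rewrite addn0.
  by rewrite addnS mulSn -addnA; apply: addL.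
have exL : exists n, `[< L (n * m + i) >].
  by exists c; apply/asboolP/c_le; rewrite mulnS -addnA leq_addr.
exists (ex_minn exL) => n; case: ex_minnP => n0 /asboolP Ln0 min.
split=> [Ln | /subnKC <-].
  exact/min/asboolP.
exact: up.
Qed.

Lemma exists_kunz_set L : is_numerical_semigroup L -> L m ->
  (forall n, q * m <= n -> L n) -> exists k, L = kunz_set k.
Proof.
move=> semiL Lm gtL.
have /fin_all_exists[k kE] (i : 'I_m) :
    exists v : 'I_q.+1, forall n, L (n * m + i) <-> v <= n.
  have [n0 n0E] := exists_least_in_class i semiL Lm.
  have lt_n0 : n0 < q.+1 by apply/n0E/gtL; rewrite leq_addr.
  by exists (Ordinal lt_n0).
exists [ffun i => k i]; apply/predeqP => x.
by rewrite (divn_eq x m) -[x %% m]/(nat_of_ord (inZp x : 'I_m)) kunz_setE ffunE.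
Qed.

End KunzWords.

Section Trace.
Variable f : nat.
Implicit Types (L : nat -> Prop) (S : {set 'I_f.+1}).

Definition trace L : {set 'I_f.+1} := [set x : 'I_f.+1 | `[< L x >]].

Lemma ext_setK : cancel (@ext_set f) trace.
Proof.
move=> S; apply/setP => x; rewrite inE /ext_set -ltnS ltn_ord inord_val.
by apply/asboolP/idP.
Qed.

Lemma traceK L : (forall n, f < n -> L n) -> ext_set (trace L) = L.
Proof.
move=> gtL; apply/predeqP => x; rewrite /ext_set; case: leqP => [le_xf | /gtL //].
by rewrite inE inordK //; split=> /asboolP.
Qed.

End Trace.

Theorem N_count_kunz (q m' : nat) (r : 'I_m'.+1) : 0 < q ->
  N_count ((q - 1) * m'.+1 + r) m'.+1 = #|[set k | semigroup_word (q := q) r k]|.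
Proof.
move=> q_gt0; set f := _ + _.
rewrite /N_count -(@card_in_imset _ _ (fun k => trace f (kunz_set k))).
  apply: eq_card => S; rewrite inE; apply/asboolP/imsetP => [inS | [k + ->]].
    have [semiS [[_ [mS _]] [gtS _]]] := inS.
    have gtqS n : q * m'.+1 <= n -> ext_set S n.
      move=> le_n; apply: gtS; apply: leq_trans le_n.
      by rewrite /f -{2}(subnK q_gt0) mulnDl mul1n ltn_add2l.
    have [k Sk] := exists_kunz_set semiS mS gtqS.
    exists k; last by rewrite -Sk ext_setK.
    by rewrite inE; apply/semigroup_wordP; rewrite -?Sk.
  rewrite inE => /semigroup_wordP - /(_ q_gt0) inK; rewrite traceK //.
  by have [_ [_ []]] := inK.
move=> k k'; rewrite !inE => /semigroup_wordP - /(_ q_gt0)[_ [_ [gtk _]]].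
move=> /semigroup_wordP - /(_ q_gt0)[_ [_ [gtk' _]]] /(congr1 (@ext_set f)).
by rewrite !traceK // => /kunz_set_inj.
Qed.

Section UpperBound.
Variables (q m' : nat).
Local Notation m := m'.+1.
Local Notation word := {ffun 'I_m -> 'I_q.+1}.
Implicit Types (k : word) (S F : {set 'I_m}) (i j s r : 'I_m).

Lemma leq_level_sum k p s i : kunz k -> p <= k s ->
  level p s i <= k i + k (s - i)%R.
Proof.
move=> /kunzP/(_ i (s - i)%R); rewrite Zp_sub_carry addrC subrK /level.
by move: (k i) (k _) => x y; lia.
Qed.

Lemma level_Zp_sub p s i : level p s (s - i : 'I_m)%R = level p s i.
Proof. by rewrite /level ltn_Zp_sub. Qed.

Definition demand p S k i j : nat :=
  if (i + j)%R \in S then level p (i + j : 'I_m)%R i - k i else 0.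

Lemma demand_le_val p S k i j : kunz k -> (forall s, s \in S -> p <= k s) ->
  demand p S k i j <= k j.
Proof.
move=> kunz_k p_le; rewrite /demand; case: ifP => // /p_le /(leq_level_sum i kunz_k).
by rewrite addrAC subrr add0r leq_subLR.
Qed.

Record fingerprint (D B t p : nat) S F k : Prop := Fingerprint {
  fingerprint_threshold_leq : p <= q;
  fingerprint_card_high : #|S| = D;
  fingerprint_card : #|F| <= B;
  fingerprint_high_sub : S \subset F;
  fingerprint_high : forall s, s \in S -> p <= k s;
  fingerprint_low : forall i s, i \notin F -> s \in S -> k i <= level p s i;
  fingerprint_undominated : forall i, #|undominated (demand p S k) F i| <= t }.

Definition fingerprint_size D t : nat := (m * q) %/ t + 2 * D.

Lemma exists_fingerprint k D t : 0 < D -> D <= m -> 0 < t ->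
  exists p S F, fingerprint D (fingerprint_size D t) t p S F k.
Proof.
move=> D_gt0 le_Dm t_gt0; pose above p := [set i | p <= k i].
have ex_p : exists p, D <= #|above p|.
  exists 0; rewrite (_ : above 0 = setT); first by rewrite cardsT card_ord.
  by apply/setP=> i; rewrite !inE.
have p_leq p : D <= #|above p| -> p <= q.
  move=> /(leq_trans D_gt0)/card_gt0P[i]; rewrite inE => /leq_trans; apply.
  by rewrite -ltnS.
have [p le_Dp maxp] := ex_maxnP ex_p p_leq.
have [S [sub_S cardS top]] := exists_top_subset (@nat_of_ord m) le_Dp.
have demand_le i j : demand p S k i j <= q.
  rewrite /demand /level; case: ifP => // _.
  by rewrite -subnDA (leq_trans (leq_subr _ _)) ?p_leq.
have [F0] := exists_dominating_set t demand_le; rewrite card_ord => cardF0 undomF0.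
exists p, S, (F0 :|: S :|: above p.+1); split=> //.
- exact: p_leq.
- have lt_above : #|above p.+1| < D by rewrite ltnNge; apply/negP => /maxp; rewrite ltnn.
  have le_F0 : #|F0| <= (m * q) %/ t by rewrite leq_divRL // mulnC.
  rewrite /fingerprint_size mul2n -addnn addnA.
  apply: leq_card_setUD (ltnW lt_above).
  by apply: leq_card_setUD le_F0 _; rewrite cardS.
- by rewrite -setUA setUCA subsetUl.
- by move=> s /(subsetP sub_S); rewrite inE.
- move=> i s; rewrite !inE !negb_or -leqNgt -andbA => /and3P[_ iS le_kp] sS.
  rewrite /level; case: (ltnP s i) => [lt_si | _]; last by rewrite subn0.
  suff : k i < p by lia.
  by rewrite ltnNge; apply: contra iS => le_pk; apply: top sS lt_si; rewrite inE.
- move=> i; apply: leq_trans (undomF0 i); apply/subset_leq_card/undominated_subset.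
  by rewrite -setUA subsetUl.
Qed.

Section CommonFingerprint.
Variables (D B t p : nat) (S F : {set 'I_m}) (A : {set word}).
Hypothesis kunzA : forall k, k \in A -> kunz k.
Hypothesis fingerprintA : forall k, k \in A -> fingerprint D B t p S F k.
Hypothesis agreeA : forall k l, k \in A -> l \in A -> {in F, k =1 l}.

Variable lo : 'I_m -> nat.
Hypothesis lo_le : forall k i, k \in A -> lo i <= k i.
Hypothesis lo_attained : forall i, exists2 k, k \in A & k i = lo i :> nat.

Let values i := [set k i | k : word in A].

Lemma card_deficient_leq i : #|[set s in S | lo i + lo (s - i)%R < level p s i]| <= t.
Proof.
have [k kA ki] := lo_attained i.
apply: leq_trans (fingerprint_undominated (fingerprintA kA) i).
rewrite -[leqLHS](card_imset _ (@subIr _ i)).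
apply/subset_leq_card/subsetP => _ /imsetP[s + ->].
rewrite !inE => /andP[sS]; apply: contraTT; rewrite -!leqNgt => dominated.
have [l lA lj] := lo_attained (s - i)%R.
have : demand p S k i (s - i)%R <= lo (s - i)%R.
  apply: leq_trans dominated _; apply/bigmax_leqP => i' i'F.
  rewrite -lj (_ : demand _ _ _ _ _ = demand p S l i' (s - i)%R).
    exact: demand_le_val (kunzA lA) (fingerprint_high (fingerprintA lA)).
  by rewrite /demand (agreeA kA lA).
by rewrite /demand addrC subrK sS ki leq_subLR.
Qed.

Lemma card_values_leq i s : i \notin F -> s \in S ->
  #|values i| + lo i <= (level p s i).+1.
Proof.
move=> iF sS; have level_ge k : k \in A -> k i <= level p s i.
  by move=> kA; exact: (fingerprint_low (fingerprintA kA) iF sS).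
have [k0 k0A k0i] := lo_attained i.
have level_leq : level p s i <= q.
  exact: leq_trans (leq_subr _ _) (fingerprint_threshold_leq (fingerprintA k0A)).
have : #|values i| <= (level p s i).+1 - lo i.
  rewrite -(card_ord_interval _ level_leq).
  apply/subset_leq_card/subsetP => _ /imsetP[k kA ->].
  by rewrite inE lo_le ?level_ge.
by have := level_ge _ k0A; rewrite k0i; lia.
Qed.

Lemma card_values_pair i s : s \in S -> i \notin F -> (s - i)%R \notin F ->
  level p s i <= lo i + lo (s - i)%R ->
  #|values i| * #|values (s - i)%R| <= csq (level p s i).
Proof.
move=> sS iF jF not_deficient; apply: leq_mul_csq.
have := card_values_leq iF sS; have := card_values_leq jF sS.
by rewrite level_Zp_sub; lia.
Qed.

Lemma card_common_fingerprint : S != set0 ->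
  exists2 s, s \in S &
    #|A| ^ 2 <= (\prod_(i < m) csq (level p s i)) * (q.+1 ^ 2) ^ ((m * t) %/ D + 2 * B).
Proof.
move=> S0; have [k0 k0A _] := lo_attained 0%R.
have fp0 := fingerprintA k0A.
have [s sS] := exists_small_section S0 card_deficient_leq.
rewrite (fingerprint_card_high fp0) card_ord mulnC => few_deficient.
pose deficient := [set i | lo i + lo (s - i)%R < level p s i].
pose exceptional := deficient :|: F :|: [set (s - i)%R | i : 'I_m in F].
have card_exceptional : #|exceptional| <= (m * t) %/ D + 2 * B.
  have D_gt0 : 0 < D by rewrite -(fingerprint_card_high fp0) card_gt0.
  have card_deficient : #|deficient| <= (m * t) %/ D by rewrite leq_divRL.
  have card_F := fingerprint_card fp0.
  rewrite mul2n -addnn addnA /exceptional.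
  apply: leq_card_setUD; first exact: leq_card_setUD.
  exact: leq_trans (leq_imset_card _ _) card_F.
have pair_le i : #|values i| * #|values (s - i)%R| <=
    csq (level p s i) * (if i \in exceptional then q.+1 ^ 2 else 1).
  case: ifP => [_|/negbT].
    have values_le j : #|values j| <= q.+1 by rewrite -[leqRHS]card_ord max_card.
    by apply: leq_trans (leq_pmull _ (csq_gt0 _)); rewrite -mulnn leq_mul.
  rewrite !inE !negb_or -leqNgt muln1 -andbA => /and3P[not_deficient iF jF].
  apply: card_values_pair => //; apply: contra jF => jF.
  by apply/imsetP; exists (s - i)%R; rewrite ?subKr.
exists s => //; apply: (@leq_trans ((\prod_i #|values i|) ^ 2)).
  by rewrite leq_sqr card_le_prod_images.
rewrite -mulnn {2}(reindex_inj (@subrI _ s)) -big_split /=.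
apply: leq_trans (leq_prod (fun i _ => pair_le i)) _.
rewrite big_split leq_mul2l -big_mkcond prod_nat_const; apply/orP; right.
by rewrite leq_pexp2l // expn_gt0.
Qed.

End CommonFingerprint.

Lemma exists_lower_envelope (A : {set word}) : A != set0 ->
  exists lo : 'I_m -> nat,
    (forall k i, k \in A -> lo i <= k i) /\
    (forall i, exists2 k, k \in A & k i = lo i :> nat).
Proof.
move=> /set0Pn[k0 k0A].
have /fin_all_exists[lo loP] (i : 'I_m) : exists v : nat,
    (forall k, k \in A -> v <= k i) /\ exists2 k, k \in A & k i = v :> nat.
  exists ([arg min_(k < k0 in A) (k i : nat)] i).
  by case: arg_minnP => // k kA min; split=> //; exists k.
by exists lo; split=> [k i | i]; have [] := loP i; auto.
Qed.

Definition encode S F k : {ffun 'I_m -> option ('I_q.+1 * bool)} :=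
  [ffun i => if i \in F then Some (k i, i \in S) else None].

Lemma domain_encode S F k : domain (encode S F k) = F.
Proof. by apply/setP => i; rewrite inE ffunE; case: (i \in F). Qed.

Lemma encode_inj S F k S' F' k' : S \subset F -> S' \subset F' ->
  encode S F k = encode S' F' k' -> [/\ S = S', F = F' & {in F, k =1 k'}].
Proof.
move=> SF SF' eq_code.
have eqF : F = F' by rewrite -(domain_encode S F k) eq_code domain_encode.
rewrite -{F'}eqF in SF' eq_code *.
have code_in i : i \in F -> k i = k' i /\ (i \in S) = (i \in S').
  by move=> iF; have /ffunP/(_ i) := eq_code; rewrite !ffunE iF => -[].
split=> // [|i /code_in[]//]; apply/setP => i.
have [/code_in[] // | iF] := boolP (i \in F).
by rewrite (contraNF (subsetP SF i) iF) (contraNF (subsetP SF' i) iF).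
Qed.

Definition fingerprint_codes D t : {set {ffun 'I_m -> option ('I_q.+1 * bool)}} :=
  small_partial_maps 'I_m ('I_q.+1 * bool)%type (fingerprint_size D t).

Lemma card_fingerprint_codes_gt0 D t : 0 < #|fingerprint_codes D t|.
Proof. exact: card_small_partial_maps_gt0. Qed.

Lemma card_fingerprint_codes_leq D t n : 0 < n ->
  n ^ m * #|fingerprint_codes D t| <= n ^ fingerprint_size D t * (n + q.+1 * 2) ^ m.
Proof.
have := card_small_partial_maps 'I_m ('I_q.+1 * bool)%type (fingerprint_size D t).
by rewrite card_prod !card_ord card_bool; apply.
Qed.

Lemma exists_fingerprint_class D t (A : {set word}) :
  0 < D -> D <= m -> 0 < t -> A != set0 ->
  exists p S F (A' : {set word}), [/\ A' \subset A,
    forall k, k \in A' -> fingerprint D (fingerprint_size D t) t p S F k,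
    forall k l, k \in A' -> l \in A' -> {in F, k =1 l} &
    #|A| <= q.+1 * #|fingerprint_codes D t| * #|A'|].
Proof.
move=> D_gt0 le_Dm t_gt0 A0.
pose codes := setX [set: 'I_q.+1] (fingerprint_codes D t).
pose has_code k (c : 'I_q.+1 * {ffun 'I_m -> option ('I_q.+1 * bool)}) :=
  `[< exists S F,
        fingerprint D (fingerprint_size D t) t c.1 S F k /\ c.2 = encode S F k >].
have coded k : k \in A -> exists2 c, c \in codes & has_code k c.
  move=> kA; have [p [S [F fp]]] := exists_fingerprint k D_gt0 le_Dm t_gt0.
  have lt_p : p < q.+1 := fingerprint_threshold_leq fp.
  exists (Ordinal lt_p, encode S F k); last by apply/asboolP; exists S, F.
  by rewrite !inE /= domain_encode (fingerprint_card fp).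
have [c _] := exists_large_fiber A0 coded; rewrite cardsX cardsT card_ord.
set A' := [set k in A | _] => card_A'.
have [k0] : exists k0, k0 \in A'.
  apply/set0Pn; apply: contraNneq A0 => A'0.
  by move: card_A'; rewrite A'0 cards0 muln0 leqn0 cards_eq0.
rewrite inE => /andP[k0A /asboolP[S [F [fp0 code0]]]].
have same k : k \in A' ->
    fingerprint D (fingerprint_size D t) t c.1 S F k /\ {in F, k0 =1 k}.
  rewrite inE => /andP[kA /asboolP[S' [F' [fp code]]]]; rewrite code0 in code.
  have [eqS eqF agree] :=
    encode_inj (fingerprint_high_sub fp0) (fingerprint_high_sub fp) code.
  by rewrite eqS eqF in agree *.
exists c.1, S, F, A'.
split=> // [|k /same[]//|k l /same[_ agree_k] /same[_ agree_l] i iF].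
  by apply/subsetP => k; rewrite inE => /andP[].
by rewrite -agree_k // agree_l.
Qed.

Lemma level_leq_level p s r i : p <= level q r s -> level p s i <= level q r i.
Proof. by rewrite /level; do 2 case: ltnP; lia. Qed.

Lemma card_kunz_words_leq r D t (A : {set word}) :
  0 < D -> D <= m -> 0 < t -> (forall k, k \in A -> kunz k) ->
  (forall k i, k \in A -> k i <= level q r i) ->
  #|A| ^ 2 <= (q.+1 * #|fingerprint_codes D t|) ^ 2 *
    ((\prod_(i < m) csq (level q r i)) *
     (q.+1 ^ 2) ^ ((m * t) %/ D + 2 * fingerprint_size D t)).
Proof.
move=> D_gt0 le_Dm t_gt0 kunzA levelA.
have [-> | A0] := eqVneq A set0; first by rewrite cards0.
have [p [S [F [A' [subA fpA' agreeA' cardA]]]]] :=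
  exists_fingerprint_class D_gt0 le_Dm t_gt0 A0.
have A'0 : A' != set0.
  apply: contraNneq A0 => A'0; move: cardA; rewrite A'0 cards0 muln0 leqn0.
  by rewrite cards_eq0.
have [lo [lo_le lo_attained]] := exists_lower_envelope A'0.
have [k kA'] := set0Pn _ A'0; have fp := fpA' k kA'.
have S0 : S != set0 by rewrite -card_gt0 (fingerprint_card_high fp).
have [s sS cardA'] := card_common_fingerprint (fun l lA' => kunzA l (subsetP subA l lA'))
  fpA' agreeA' lo_le lo_attained S0.
apply: (@leq_trans (_ ^ 2)); first by rewrite leq_sqr; apply: cardA.
rewrite expnMn leq_mul2l; apply/orP; right; apply: leq_trans cardA' _.
rewrite leq_mul2r; apply/orP; right; apply: leq_prod => i _; apply/leq_csq/level_leq_level.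
exact: leq_trans (fingerprint_high fp sS) (levelA _ _ (subsetP subA _ kA')).
Qed.

End UpperBound.

Section LowerBound.
Variables (q m' : nat).
Local Notation m := m'.+1.
Local Notation word := {ffun 'I_m -> 'I_q.+1}.
Variable r : 'I_m.
Hypotheses (q_ge3 : 3 <= q) (r_neq0 : r != 0%R).
Implicit Types (k : word) (i j : 'I_m).

(* Half of [q], corrected beyond two thresholds so that on a pair [i], [r - i] the
   values are the two halves of the common level, rounded up and down. *)
Definition box_lo (i : nat) : nat := (q + (i.*2 <= r) - (m + r < i.*2))./2.

Lemma box_lo_gt0 i : 0 < box_lo i.
Proof. by rewrite /box_lo; lia. Qed.

Lemma box_lo_leq i : box_lo i <= level q r i.
Proof. by rewrite /box_lo /level; have := ltn_ord i; do 3 case: ltnP; lia. Qed.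

Lemma level_leq_box_lo i j :
  level q r (i + j : 'I_m)%R <= box_lo i + box_lo j + (m <= i + j).
Proof.
rewrite /level val_Zp_add /box_lo.
have := ltn_ord i; have := ltn_ord j; have := ltn_ord r.
case: (ltnP (i + j) m); do 5 case: ltnP; lia.
Qed.

Lemma box_lo_pair i : i.*2 <> r -> i.*2 <> m + r ->
  box_lo i = (level q r i)./2 /\ box_lo (r - i : 'I_m)%R = uphalf (level q r i) \/
  box_lo i = uphalf (level q r i) /\ box_lo (r - i : 'I_m)%R = (level q r i)./2.
Proof.
move=> ir imr; have := val_Zp_add i (r - i)%R; rewrite addrC subrK.
have := Zp_sub_carry r i; rewrite /level /box_lo; move: (r - i)%R => j.
have := ltn_ord i; have := ltn_ord j.
case: (ltnP (i + j) m) => wrap lt_jm lt_im /esym ri rE.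
  rewrite ri subn0.
  have [le_i|lt_i] := leqP i.*2 r; [right | left]; lia.
rewrite ri.
have [le_i|lt_i] := leqP i.*2 (m + r); [right | left]; lia.
Qed.

Definition box_side i : {set 'I_q.+1} :=
  if i == 0%R then [set ord0] else
  if i == r then [set ord_max] else [set v : 'I_q.+1 | box_lo i <= v <= level q r i].

Definition box : {set word} := setXn box_side.

Lemma card_box_side i : i != 0%R -> i != r ->
  #|box_side i| = (level q r i).+1 - box_lo i.
Proof.
by move=> i0 ir; rewrite /box_side (negPf i0) (negPf ir) card_ord_interval ?leq_subr.
Qed.

Lemma card_box_side_gt0 i : 0 < #|box_side i|.
Proof.
have [-> | i0] := eqVneq i 0%R; first by rewrite /box_side eqxx cards1.
have [-> | ir] := eqVneq i r.
  by rewrite /box_side eqxx; case: eqP => _; rewrite cards1.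
by rewrite card_box_side // subn_gt0 ltnS box_lo_leq.
Qed.

(* The last two are the possible fixed points of [i |-> r - i]. *)
Definition box_exception i : bool := (i : nat) \in [:: 0; r : nat; r./2; (m + r)./2].

Lemma card_box_exception : #|[set i | box_exception i]| <= 4.
Proof.
rewrite cardE -(size_map (@nat_of_ord _)) -[4]/(size [:: 0; r : nat; r./2; (m + r)./2]).
apply: uniq_leq_size; first by rewrite map_inj_uniq ?enum_uniq //; apply: ord_inj.
by move=> _ /mapP[i + ->]; rewrite mem_enum inE.
Qed.

Lemma card_box_side_pair i : ~~ box_exception i ->
  #|box_side i| * #|box_side (r - i)%R| = csq (level q r i).
Proof.
rewrite /box_exception !inE !negb_or => /and4P[i0 ir ir2 imr2].
rewrite !card_box_side ?subr_eq0 //; last first.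
- by rewrite -subr_eq0 addrC addKr oppr_eq0.
- by rewrite eq_sym.
rewrite level_Zp_sub csqE; set l := level q r i.
have half_sub : l.+1 - l./2 = (uphalf l).+1 by lia.
have uphalf_sub : l.+1 - uphalf l = l./2.+1 by lia.
have [||[-> ->]|[-> ->]] := @box_lo_pair i; [lia | lia | |];
  by rewrite half_sub uphalf_sub // mulnC.
Qed.

Lemma boxP k : k \in box ->
  [/\ k 0%R = ord0, k r = ord_max, forall i, i != 0%R -> box_lo i <= k i &
      forall i, k i <= level q r i].
Proof.
move=> /setXnP k_side.
have k0 : k 0%R = ord0 by have := k_side 0%R; rewrite /box_side eqxx inE => /eqP.
have kr : k r = ord_max.
  by have := k_side r; rewrite /box_side (negPf r_neq0) eqxx inE => /eqP.
have between i : i != 0%R -> box_lo i <= k i <= level q r i.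
  move=> i0; have [-> | ir] := eqVneq i r.
    by rewrite kr (leq_trans (box_lo_leq r)) ?leq_subr //= /level ltnn subn0.
  by have := k_side i; rewrite /box_side (negPf i0) (negPf ir) inE.
split=> // i; first by move=> /between/andP[].
by have [-> | /between/andP[]//] := eqVneq i 0%R; rewrite k0.
Qed.

Lemma box_semigroup_word k : k \in box -> semigroup_word r k.
Proof.
move=> /boxP[k0 kr lo_le le_level]; apply/and4P; split.
- apply/kunzP => i j.
  have [-> | i0] := eqVneq i 0%R; first by rewrite add0r -addnA addnCA leq_addr.
  have [-> | j0] := eqVneq j 0%R; first by rewrite addr0 -addnA leq_addr.
  apply: leq_trans (le_level _) (leq_trans (level_leq_box_lo i j) _).
  by rewrite leq_add2r leq_add ?lo_le.
- exact/eqP.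
- exact/forallP.
- apply/forallP => i; have [-> | i0] := eqVneq i 0%R; first by rewrite k0 eqxx.
  by rewrite eqbF_neg -val_eqE -lt0n (leq_trans (box_lo_gt0 i)) ?lo_le.
Qed.

Lemma prod_csq_leq_N_count :
  \prod_(i < m) csq (level q r i) <= N_count ((q - 1) * m + r) m ^ 2 * csq q ^ 4.
Proof.
have card_box_leq : #|box| <= N_count ((q - 1) * m + r) m.
  rewrite N_count_kunz; last exact: leq_trans q_ge3.
  by apply/subset_leq_card/subsetP => k /box_semigroup_word; rewrite inE.
apply: (@leq_trans (#|box| ^ 2 * csq q ^ 4)); last first.
  by rewrite leq_mul2r leq_sqr card_box_leq orbT.
have pair_leq i : csq (level q r i) <= #|box_side i| * #|box_side (r - i)%R| *
    (if box_exception i then csq q else 1).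
  case: ifP => [_ | /negbT/card_box_side_pair->]; last by rewrite muln1.
  apply: leq_trans (leq_csq (leq_subr _ _)) _.
  by apply: leq_pmull; rewrite muln_gt0 !card_box_side_gt0.
apply: leq_trans (leq_prod (fun i _ => pair_leq i)) _.
rewrite !big_split cardsXn -mulnn {3}(reindex_inj (@subrI _ r)) leq_mul2l.
apply/orP; right; rewrite -big_mkcond prod_nat_const leq_pexp2l ?csq_gt0 //.
by apply: leq_trans card_box_exception; apply/eq_leq/eq_card => i; rewrite inE.
Qed.

End LowerBound.

Section Asymptotics.
Local Open Scope R_scope.

Lemma INR_addn a b : INR (a + b)%N = INR a + INR b.
Proof. exact: plus_INR. Qed.

Lemma INR_muln a b : INR (a * b)%N = INR a * INR b.
Proof. exact: mult_INR. Qed.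

Lemma INR_expn a n : INR (a ^ n)%N = INR a ^ n.
Proof. by elim: n => // n IHn; rewrite expnS INR_muln IHn. Qed.

Lemma INR_leq a b : (a <= b)%N -> INR a <= INR b.
Proof. by move/leP; apply: le_INR. Qed.

Lemma INR_gt0 a : (0 < a)%N -> 0 < INR a.
Proof. by move/ltP; apply: lt_0_INR. Qed.

Lemma INR_divn_leq a b : (0 < b)%N -> INR (a %/ b)%N <= INR a / INR b.
Proof.
move=> b_gt0; apply/Rcomplements.Rle_div_r; first exact: INR_gt0.
by rewrite -INR_muln; apply/INR_leq/leq_trunc_div.
Qed.

Lemma exists_nat_mul_ge C e : 0 < e -> exists2 n, (0 < n)%N & C <= e * INR n.
Proof.
move=> e_gt0; have [n lt_n] := INR_unbounded (C / e); exists n.+1 => //.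
rewrite Rmult_comm; apply/Rcomplements.Rle_div_l => //.
by rewrite S_INR; lra.
Qed.

Definition lnn (n : nat) : R := ln (INR n).

Lemma lnn_mul a b : (0 < a)%N -> (0 < b)%N -> lnn (a * b) = lnn a + lnn b.
Proof. by move=> a_gt0 b_gt0; rewrite /lnn INR_muln ln_mult //; apply: INR_gt0. Qed.

Lemma lnn_exp a n : (0 < a)%N -> lnn (a ^ n) = INR n * lnn a.
Proof. by move=> a_gt0; rewrite /lnn INR_expn ln_pow //; apply: INR_gt0. Qed.

Lemma lnn_leq a b : (0 < a)%N -> (a <= b)%N -> lnn a <= lnn b.
Proof.
by move=> a_gt0 le_ab; apply: Rcomplements.ln_le; [apply: INR_gt0 | apply: INR_leq].
Qed.

Lemma lnn_ge0 a : (0 < a)%N -> 0 <= lnn a.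
Proof. by move=> a_gt0; rewrite -ln_1; apply: (@lnn_leq 1). Qed.

Lemma lnn_add_le a b : (0 < a)%N -> lnn (a + b) <= lnn a + INR b / INR a.
Proof.
move=> /INR_gt0 a_gt0; rewrite /lnn INR_addn.
have ba_ge0 : 0 <= INR b / INR a by apply: Rle_mult_inv_pos => //; apply: pos_INR.
have -> : INR a + INR b = INR a * (1 + INR b / INR a) by field; lra.
rewrite ln_mult //; last lra.
apply: Rplus_le_compat_l; rewrite -{2}(ln_exp (INR b / INR a)).
by apply: Rcomplements.ln_le; [lra | apply: exp_ineq1_le].
Qed.

Lemma lnn_leq_INR a : (0 < a)%N -> lnn a <= INR a.
Proof.
move=> /INR_gt0 a_gt0; rewrite -[X in _ <= X](ln_exp (INR a)).
by apply: Rcomplements.ln_le => //; have := exp_ineq1_le (INR a); lra.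
Qed.

Lemma lnn_csq q : lnn (csq q) = 2 * ln (c_ q).
Proof.
have csq_gt0 : 0 < INR (csq q) := INR_gt0 (csq_gt0 q).
rewrite /lnn -(pow2_sqrt (INR (csq q))); last exact: Rlt_le.
by rewrite ln_pow //; apply: sqrt_lt_R0.
Qed.

Lemma ln_c_le p q : (p <= q)%N -> ln (c_ p) <= ln (c_ q).
Proof. by move=> /leq_csq/(lnn_leq (csq_gt0 p)); rewrite !lnn_csq; lra. Qed.

Lemma ln_c_gt0 q : (0 < q)%N -> 0 < ln (c_ q).
Proof.
have csq1_gt0 : 0 < lnn (csq 1).
  by rewrite -ln_1; apply: ln_increasing; rewrite /csq /=; lra.
by move=> /leq_csq/(lnn_leq (csq_gt0 1)); rewrite (lnn_csq q); lra.
Qed.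

Definition main_term (q m r : nat) : R :=
  INR r * ln (c_ q) + (INR m - INR r) * ln (c_ (q - 1)).

Lemma prod_csq_level_gt0 q m r : (0 < \prod_(i < m) csq (level q r i))%N.
Proof. by apply: prodn_gt0 => i; apply: csq_gt0. Qed.

Lemma prod_csq_level q m r : (r < m)%N ->
  (\prod_(i < m) csq (level q r i) = csq q ^ r.+1 * csq (q - 1) ^ (m - r.+1))%N.
Proof.
move=> lt_rm; rewrite -(big_mkord xpredT (fun i => csq (level q r i))).
rewrite (big_cat_nat _ (n := r.+1)) //=; congr (_ * _)%N.
  rewrite -[X in (_ ^ X)%N]subn0 -prod_nat_const_nat.
  apply: eq_big_nat => i /andP[_ le_ir].
  by rewrite /level ltnNge -ltnS le_ir subn0.
rewrite -prod_nat_const_nat; apply: eq_big_nat => i /andP[lt_ri _].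
by rewrite /level lt_ri.
Qed.

Lemma lnn_prod_csq_level q m r : (r < m)%N ->
  lnn (\prod_(i < m) csq (level q r i)) =
  2 * (main_term q m r + ln (c_ q) - ln (c_ (q - 1))).
Proof.
move=> lt_rm; rewrite prod_csq_level // lnn_mul ?expn_gt0 ?csq_gt0 //.
rewrite !lnn_exp ?csq_gt0 // !lnn_csq /main_term S_INR.
rewrite minus_INR ?S_INR; last exact/leP.
ring.
Qed.

Lemma lnn_N_count_ge q m r : (3 <= q)%N -> (0 < r)%N -> (r < m)%N ->
  (0 < N_count ((q - 1) * m + r) m)%N /\
  main_term q m r - 4 * ln (c_ q) <= lnn (N_count ((q - 1) * m + r) m).
Proof.
case: m => // m' q_ge3 r_gt0 lt_rm.
have r_neq0 : Ordinal lt_rm != 0%R by rewrite -val_eqE /= -lt0n.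
have := prod_csq_leq_N_count q_ge3 r_neq0; rewrite /=.
set N := N_count _ _ => prod_leq; have prod_gt0 := prod_csq_level_gt0 q m'.+1 r.
have N_gt0 : (0 < N)%N.
  by case: posnP prod_leq => // ->; rewrite exp0n // mul0n leqNgt prod_gt0.
split=> //; have := lnn_leq prod_gt0 prod_leq.
rewrite lnn_prod_csq_level // lnn_mul ?expn_gt0 ?N_gt0 ?csq_gt0 //.
rewrite !lnn_exp ?csq_gt0 // lnn_csq /=.
by have := ln_c_le (leq_subr 1 q); lra.
Qed.

Lemma lnn_card_fingerprint_codes q m' D t n : (0 < n)%N ->
  lnn #|fingerprint_codes q m' D t| <=
  INR (fingerprint_size q m' D t) * lnn n + INR m'.+1 * (INR (q.+1 * 2) / INR n).
Proof.
move=> n_gt0; have codes_gt0 := card_fingerprint_codes_gt0 q m' D t.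
have sum_gt0 : (0 < n + q.+1 * 2)%N by rewrite addn_gt0 n_gt0.
have /lnn_leq := card_fingerprint_codes_leq q m' D t n_gt0.
rewrite !lnn_mul ?muln_gt0 ?expn_gt0 ?n_gt0 ?sum_gt0 // => /(_ codes_gt0).
rewrite !lnn_exp //.
by have := Rmult_le_compat_l _ _ _ (pos_INR m'.+1) (lnn_add_le (q.+1 * 2) n_gt0); lra.
Qed.

Lemma lnn_N_count_le_codes q m' r D t : (0 < q)%N -> (r < m'.+1)%N -> (0 < D)%N ->
  (D <= m'.+1)%N -> (0 < t)%N -> (0 < N_count ((q - 1) * m'.+1 + r) m'.+1)%N ->
  lnn (N_count ((q - 1) * m'.+1 + r) m'.+1) <=
  main_term q m'.+1 r + ln (c_ q) - ln (c_ (q - 1)) +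
  lnn #|fingerprint_codes q m' D t| +
  (1 + INR ((m'.+1 * t) %/ D) + 2 * INR (fingerprint_size q m' D t)) * lnn q.+1.
Proof.
move=> q_gt0 lt_rm D_gt0 le_Dm t_gt0; set N := N_count _ _ => N_gt0.
pose A := [set k : {ffun 'I_m'.+1 -> 'I_q.+1} | semigroup_word (Ordinal lt_rm) k].
have cardA : N = #|A| := N_count_kunz (Ordinal lt_rm) q_gt0.
have kunzA k : k \in A -> kunz k by rewrite inE => /and4P[].
have levelA k i : k \in A -> (k i <= level q (Ordinal lt_rm) i)%N.
  by rewrite inE => /and4P[_ _ /forallP/(_ i)].
have := card_kunz_words_leq D_gt0 le_Dm t_gt0 kunzA levelA.
set G := #|fingerprint_codes _ _ _ _|; set B := fingerprint_size _ _ _ _.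
set tau := (_ %/ _)%N.
have G_gt0 : (0 < G)%N := card_fingerprint_codes_gt0 q m' D t.
have prod_gt0 := prod_csq_level_gt0 q m'.+1 r.
rewrite -cardA /= => /lnn_leq.
rewrite !lnn_mul ?muln_gt0 ?expn_gt0 ?N_gt0 ?G_gt0 ?prod_gt0 // => /(_ isT).
by rewrite lnn_prod_csq_level // !lnn_exp ?expn_gt0 // INR_addn INR_muln /=; lra.
Qed.

(* With [D = n ^ 4] and [t = n ^ 2] both the size and [m * t / D] are of order
   [m / n ^ 2], hence [O(m / n)] even after multiplication by [ln n <= n]. *)
Lemma fingerprint_cost_le q m' n : (0 < n)%N ->
  INR (fingerprint_size q m' (n ^ 4) (n ^ 2)) * (lnn n + 2 * lnn q.+1) +
  INR ((m'.+1 * n ^ 2) %/ n ^ 4) * lnn q.+1 <=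
  (INR q * (1 + 2 * lnn q.+1) + lnn q.+1) * (INR m'.+1 / INR n) +
  2 * INR n ^ 4 * (INR n + 2 * lnn q.+1).
Proof.
move=> n_gt0; have n4_gt0 : (0 < n ^ 4)%N by rewrite expn_gt0 n_gt0.
have n2_gt0 : (0 < n ^ 2)%N by rewrite expn_gt0 n_gt0.
have In_ge1 : 1 <= INR n := INR_leq n_gt0.
pose x := INR m'.+1 / INR n; pose u := x / INR n; rewrite -/x.
have u_ge0 : 0 <= u by do 2 (apply: Rle_mult_inv_pos; last lra); apply: pos_INR.
have un : u * INR n = x by rewrite /u; field; lra.
have qu_ge0 : 0 <= INR q * u by apply: Rmult_le_pos => //; apply: pos_INR.
have size_le : INR (fingerprint_size q m' (n ^ 4) (n ^ 2)) <= INR q * u + 2 * INR n ^ 4.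
  rewrite INR_addn [INR (2 * _)]INR_muln -INR_expn; apply: Rplus_le_compat_r.
  apply: Rle_trans (INR_divn_leq _ n2_gt0) (Req_le _ _ _).
  by rewrite INR_muln INR_expn /u /x; field; lra.
have ratio_le : INR ((m'.+1 * n ^ 2) %/ n ^ 4) <= u.
  apply: Rle_trans (INR_divn_leq _ n4_gt0) (Req_le _ _ _).
  by rewrite INR_muln !INR_expn /u /x; field; lra.
have lQ_ge0 : 0 <= lnn q.+1 by apply: lnn_ge0.
have ln_n_le := lnn_leq_INR n_gt0; have ln_n_ge0 := lnn_ge0 n_gt0.
have le_x : u * lnn q.+1 <= x * lnn q.+1.
  by apply: Rmult_le_compat_r => //; rewrite -un; nra.
have sum_ge0 : 0 <= lnn n + 2 * lnn q.+1 by lra.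
have factor_le : lnn n + 2 * lnn q.+1 <= INR n * (1 + 2 * lnn q.+1) by nra.
have n4_factor_le :
    INR n ^ 4 * (lnn n + 2 * lnn q.+1) <= INR n ^ 4 * (INR n + 2 * lnn q.+1).
  by apply: Rmult_le_compat_l; [apply: pow_le; lra | lra].
have := Rmult_le_compat_l _ _ _ qu_ge0 factor_le.
have := Rmult_le_compat_r _ _ _ sum_ge0 size_le.
have := Rmult_le_compat_r _ _ _ lQ_ge0 ratio_le.
by rewrite -un in le_x *; lra.
Qed.

Lemma lnn_N_count_le q : (0 < q)%N -> exists K, forall n, (0 < n)%N ->
  exists C, forall m r, (n ^ 4 <= m)%N -> (r < m)%N ->
    (0 < N_count ((q - 1) * m + r) m)%N ->
    lnn (N_count ((q - 1) * m + r) m) <= main_term q m r + K * (INR m / INR n) + C.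
Proof.
move=> q_gt0; pose lQ := lnn q.+1; pose Q2 := INR (q.+1 * 2).
exists (INR q * (1 + 2 * lQ) + lQ + Q2) => n n_gt0.
exists (ln (c_ q) + lQ + 2 * INR n ^ 4 * (INR n + 2 * lQ)).
move=> [//|m'] r le_nm lt_rm N_gt0.
have n4_gt0 : (0 < n ^ 4)%N by rewrite expn_gt0 n_gt0.
have n2_gt0 : (0 < n ^ 2)%N by rewrite expn_gt0 n_gt0.
have := lnn_N_count_le_codes q_gt0 lt_rm n4_gt0 le_nm n2_gt0 N_gt0.
have := lnn_card_fingerprint_codes q m' (n ^ 4) (n ^ 2) n_gt0.
have := fingerprint_cost_le q m' n_gt0.
have := lnn_ge0 (csq_gt0 (q - 1)); rewrite lnn_csq -/lQ -/Q2.
have In_gt0 := INR_gt0 n_gt0.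
have -> : INR m'.+1 * (Q2 / INR n) = Q2 * (INR m'.+1 / INR n) by field; lra.
lra.
Qed.

Lemma lnn_N_count_asymptotic q : (3 <= q)%N -> forall eta, 0 < eta ->
  exists M, forall m r, (M <= m)%N -> (0 < r)%N -> (r < m)%N ->
    (0 < N_count ((q - 1) * m + r) m)%N /\
    Rabs (lnn (N_count ((q - 1) * m + r) m) - main_term q m r) <= eta * INR m.
Proof.
move=> q_ge3 eta eta_gt0; have eta2_gt0 : 0 < eta / 2 by lra.
have [K upper] := lnn_N_count_le (leq_trans (isT : 0 < 3)%N q_ge3).
have [n n_gt0 K_le] := exists_nat_mul_ge K eta2_gt0.
have [C {}upper] := upper n n_gt0.
have [M _ C_le] := exists_nat_mul_ge (Rmax C (4 * ln (c_ q))) eta2_gt0.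
exists (maxn M (n ^ 4)) => m r; rewrite geq_max => /andP[le_Mm le_nm] r_gt0 lt_rm.
have [N_gt0 lower] := lnn_N_count_ge q_ge3 r_gt0 lt_rm; split=> //.
have {}upper := upper m r le_nm lt_rm N_gt0.
have In_gt0 := INR_gt0 n_gt0.
have Kmn_le : K * (INR m / INR n) <= eta / 2 * INR m.
  have -> : K * (INR m / INR n) = K * INR m / INR n by field; lra.
  apply/Rcomplements.Rle_div_l => //.
  by have := Rmult_le_compat_r _ _ _ (pos_INR m) K_le; lra.
have eta_m_ge : Rmax C (4 * ln (c_ q)) <= eta / 2 * INR m.
  by apply: Rle_trans C_le _; apply: Rmult_le_compat_l; [lra | apply: INR_leq].
have := Rmax_l C (4 * ln (c_ q)); have := Rmax_r C (4 * ln (c_ q)).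
have : 0 <= eta / 2 * INR m by apply: Rmult_le_pos; [lra | apply: pos_INR].
by move=> *; apply: Rabs_le; split; lra.
Qed.

Lemma exists_Rpower_exponent b m N l d : 0 < N -> 0 < l -> l <= ln b ->
  Rabs (ln N - m * ln b) <= d * l -> exists E, N = Rpower b (m + E) /\ Rabs E <= d.
Proof.
move=> N_gt0 l_gt0 l_le dist_le; exists ((ln N - m * ln b) / ln b); split.
  by rewrite /Rpower -[LHS]exp_ln //; congr exp; field; lra.
have lnb_gt0 : 0 < ln b by lra.
rewrite Rcomplements.Rabs_div ?(Rabs_pos_eq (ln b)); try lra.
apply/Rcomplements.Rle_div_l => //; apply: (Rle_trans _ _ _ dist_le).
apply: Rmult_le_compat_l => //.
apply: (Rmult_le_reg_r l) => //; rewrite Rmult_0_l.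
exact: Rle_trans (Rabs_pos _) dist_le.
Qed.

Definition growth_base q f m : R :=
  Rpower (c_ q) (alpha q f m) * Rpower (c_ (q - 1)) (1 - alpha q f m).

Lemma ln_growth_base q m r : (0 < q)%N -> (0 < m)%N ->
  ln (growth_base q ((q - 1) * m + r) m) =
  INR r / INR m * ln (c_ q) + (1 - INR r / INR m) * ln (c_ (q - 1)).
Proof.
move=> q_gt0 /INR_gt0 m_gt0; rewrite ln_mult ?ln_Rpower; try exact: exp_pos.
have -> // : alpha q ((q - 1) * m + r) m = INR r / INR m.
rewrite /alpha INR_addn INR_muln minus_INR; last exact/leP.
by rewrite [INR 1]/=; field; lra.
Qed.

Lemma mul_ln_growth_base q m r : (0 < q)%N -> (0 < m)%N ->
  INR m * ln (growth_base q ((q - 1) * m + r) m) = main_term q m r.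
Proof.
move=> q_gt0 m_gt0; rewrite ln_growth_base // /main_term.
by field; have := INR_gt0 m_gt0; lra.
Qed.

Lemma ln_growth_base_ge q m r : (0 < q)%N -> (0 < m)%N ->
  ln (c_ (q - 1)) <= ln (growth_base q ((q - 1) * m + r) m).
Proof.
move=> q_gt0 m_gt0; rewrite ln_growth_base //.
have ratio_ge0 : 0 <= INR r / INR m.
  by apply: Rle_mult_inv_pos; [apply: pos_INR | apply: INR_gt0].
by have := Rmult_le_compat_l _ _ _ ratio_ge0 (ln_c_le (leq_subr 1 q)); lra.
Qed.

End Asymptotics.

Theorem theorem1p3 (q : nat) (hq : (3 <= q)%N) :
  forall eps : R, Rlt R0 eps ->
  exists M : nat, forall f m : nat,
    (M <= m)%N -> ((q - 1) * m < f)%N -> (f < q * m)%N ->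
    exists E : R,
      INR (N_count f m) =
        Rpower (Rmult (Rpower (c_ q) (alpha q f m))
                      (Rpower (c_ (q - 1)) (Rminus R1 (alpha q f m))))
               (Rplus (INR m) E)
      /\ Rle (Rabs E) (Rmult eps (INR m)).
Proof.
move=> eps eps_gt0; have q_gt0 : 0 < q by lia.
have lc_gt0 : (0 < ln (c_ (q - 1)))%Re by apply: ln_c_gt0; lia.
have [M asymptotic] := lnn_N_count_asymptotic hq (Rmult_lt_0_compat _ _ eps_gt0 lc_gt0).
exists M => f m le_Mm lt_f f_lt.
have [r fE] : exists r, f = (q - 1) * m + r by exists (f - (q - 1) * m); lia.
have [r_gt0 lt_rm] : 0 < r /\ r < m by split; nia.
have m_gt0 := ltn_trans r_gt0 lt_rm.
have [N_gt0 close] := asymptotic m r le_Mm r_gt0 lt_rm.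
rewrite fE.
apply: (exists_Rpower_exponent (b := growth_base q _ m) (INR_gt0 N_gt0) lc_gt0).
  exact: ln_growth_base_ge.
by rewrite mul_ln_growth_base //; apply: Rle_trans close _; lra.
Qed.
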